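(* There is an absolute constant $c>0$ such that the following holds. Let $0\le \varepsilon_1<\varepsilon_2\le 1$, let $n,m$ be positive integers with $m\ge c$. Suppose there exist real random variables $U,U'$ supported on an interval $[a,b]$ with $0\le a<b$ and $b-a\le \varepsilon_2^2/1000$, such that $\mathbb{E}[U]=\mathbb{E}[U']=1/n$, \[ \mathbb{E}\Big[\Big|U-\frac1n\Big|\Big]\le \frac{\varepsilon_1}{n},\qquad \mathbb{E}\Big[\Big|U'-\frac1n\Big|\Big]\ge \frac{\varepsilon_2}{n}, \] and \[ \operatorname{TV}\big(\mathbb{E}\,\mathrm{Poi}(mU),\ \mathbb{E}\,\mathrm{Poi}(mU')\big)\le \frac{1}{20n}. \] Then any tester which, for every unknown distribution $p$ over $[n]$, distinguishes between $\|p-\mathrm{Unif}_n\|_1\le 25\varepsilon_1$ and $\|p-\mathrm{Unif}_n\|_1\ge \varepsilon_2/2$ with probability at least $4/5$ requires at least $m/2$ samples from $p$.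
   Context: $\mathbb{E}\,\mathrm{Poi}(mU)$ denotes the mixture distribution on $\{0,1,2,\dots\}$ obtained by first drawing $U$ and then drawing a Poisson variable with mean $mU$. $\operatorname{TV}$ is total variation distance. $\mathrm{Unif}_n$ is the uniform distribution on $[n]$, $\|p-q\|_1=\sum_i|p_i-q_i|$. A tester receives i.i.d. samples from $p$ and must output ''close'' with probability $\ge4/5$ in the first case and ''far'' with probability $\ge4/5$ in the second. *)

(* Defs.v *)
From HB Require Import structures.
From mathcomp Require Import all_boot all_order all_algebra.
From mathcomp Require Import all_classical all_reals all_analysis.
Set Implicit Arguments. Unset Strict Implicit. Unset Printing Implicit Defensive.
Import Order.TTheory GRing.Theory Num.Theory.
Local Open Scope classical_set_scope.
Local Open Scope ring_scope.

(* Poisson probability mass function with mean [r >= 0]: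
   P(Poi(r) = k) = e^{-r} r^k / k!  (with 0^0 = 1, so Poi(0) = delta_0).
   (The library's [poisson_pmf] returns 1 at rate 0, hence not used.) *)
Definition poi_pmf {R : realType} (r : R) (k : nat) : R :=
  expR (- r) * r ^+ k / k`!%:R.

Definition poi_mix {R : realType} (mu : probability R R) (m : nat) (k : nat)
  : \bar R :=
  (\int[mu]_x (poi_pmf (m%:R * x) k)%:E)%E.

Definition tv_nat {R : realType} (P Q : nat -> \bar R) : \bar R :=
  ((2%:R^-1)%:E * \sum_(0 <= k <oo) `|P k - Q k|)%E.

Definition is_distr {R : realType} (n : nat) (p : 'I_n -> R) : Prop :=
  (forall i, 0 <= p i) /\ \sum_(i < n) p i = 1.

Definition l1_unif {R : realType} (n : nat) (p : 'I_n -> R) : R :=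
  \sum_(i < n) `|p i - n%:R^-1|.

(* A (possibly randomized) tester using s samples from [n] is given by
   T : sample vector -> [0,1], the probability that it outputs "close". *)
Definition is_tester {R : realType} (n s : nat) (T : {ffun 'I_s -> 'I_n} -> R)
  : Prop := forall x, 0 <= T x <= 1.

Definition prob_close {R : realType} (n s : nat) (T : {ffun 'I_s -> 'I_n} -> R)
  (p : 'I_n -> R) : R :=
  \sum_(x : {ffun 'I_s -> 'I_n}) (\prod_(i < s) p (x i)) * T x.

Definition tester_succeeds {R : realType} (n s : nat)
  (T : {ffun 'I_s -> 'I_n} -> R) (d1 d2 : R) : Prop :=
  is_tester T /\
  forall p : 'I_n -> R, is_distr p ->
    (l1_unif p <= d1 -> 4 / 5 <= prob_close T p) /\
    (d2 <= l1_unif p -> 1 - prob_close T p >= 4 / 5).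

(* Main.v *)
Require Import Defs.
From HB Require Import structures.
From mathcomp Require Import all_boot all_order all_algebra.
From mathcomp Require Import all_classical all_reals all_analysis.
From mathcomp Require Import measurable_realfun ring lra.
Import Order.TTheory GRing.Theory Num.Theory numFieldNormedType.Exports.
Local Open Scope classical_set_scope.
Local Open Scope ring_scope.
Set Implicit Arguments.
Unset Strict Implicit.
Unset Printing Implicit Defensive.

(* Draw the coordinates of u independently from the law of U and give symbol j
   a Poisson(m u_j) number of occurrences, in random order.  If S = sum_j u_j is
   near 1, there are at least s < m/2 symbols with high probability, and given
   their number they are i.i.d. from u / S, so a tester using s samples applies.
   By Markov and Chebyshev, u / S is (25 eps1)-close to uniform under U and
   (eps2/2)-far under U' with good probability, so the acceptance probabilities
   differ by at least 3/10.  On the other hand they only depend on the symbol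
   counts, whose laws are within n * TV <= 1/20, a contradiction.

   Every quantity averaged over u is a finite sum of products of functions of
   single coordinates (totals are cut at 2m + s), so only one-dimensional
   integrals are needed. *)

(** * One-dimensional expectations *)

(** Boundedness is asked only on [a, b], since the Poisson weights are unbounded at negative rates.
    The class is closed under sums and products, and its members are integrable on [a, b] for any
    probability. *)
Definition bmeas {R : realType} (a b : R) (f : R -> R) : Prop :=
  measurable_fun [set: R] f /\
  exists C : R, forall x, a <= x <= b -> `|f x| <= C.

Definition expect_itv {R : realType} (a b : R) (mu : probability R R)
  (f : R -> R) : R := (\int[mu]_(x in `[a, b]) f x)%R.

Lemma bmeas_cst (R : realType) (a b c : R) : bmeas a b (fun=> c).
Proof. by split=> //; exists `|c|. Qed.

Lemma bmeas_id (R : realType) (a b : R) : bmeas a b (fun x => x).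
Proof.
split=> //; exists (`|a| + `|b|) => x /andP[ax xb].
have := ler_norm b; have := ler_norm (- a); have := normr_ge0 a.
have := normr_ge0 b; rewrite normrN => *.
by rewrite ler_norml; apply/andP; split; lra.
Qed.

Lemma bmeasD (R : realType) (a b : R) (f g : R -> R) :
  bmeas a b f -> bmeas a b g -> bmeas a b (fun x => f x + g x).
Proof.
move=> [mf [C fC]] [mg [D gD]]; split; first exact: measurable_funD.
exists (C + D) => x xab; apply: le_trans (ler_normD _ _) _.
by rewrite lerD ?fC ?gD.
Qed.

Lemma bmeasM (R : realType) (a b : R) (f g : R -> R) :
  bmeas a b f -> bmeas a b g -> bmeas a b (fun x => f x * g x).
Proof.
move=> [mf [C fC]] [mg [D gD]]; split; first exact: measurable_funM.
by exists (C * D) => x xab; rewrite normrM ler_pM ?fC ?gD.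
Qed.

Lemma bmeasZ (R : realType) (a b c : R) (f : R -> R) :
  bmeas a b f -> bmeas a b (fun x => c * f x).
Proof. by move=> mf; apply: bmeasM => //; exact: bmeas_cst. Qed.

Lemma bmeas_norm (R : realType) (a b : R) (f : R -> R) :
  bmeas a b f -> bmeas a b (fun x => `|f x|).
Proof.
move=> [mf [C fC]]; split; first exact: measurableT_comp.
by exists C => x xab; rewrite normr_id fC.
Qed.

Lemma bmeas_exp (R : realType) (a b : R) (f : R -> R) (k : nat) :
  bmeas a b f -> bmeas a b (fun x => f x ^+ k).
Proof.
move=> mf; elim: k => [|k IH].
  by under eq_fun do rewrite expr0; exact: bmeas_cst.
by under eq_fun do rewrite exprS; exact: bmeasM.
Qed.

Lemma bmeas_sum (R : realType) (a b : R) (I : Type) (l : seq I)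
    (f : I -> R -> R) :
  (forall i, bmeas a b (f i)) -> bmeas a b (fun x => \sum_(i <- l) f i x).
Proof.
move=> mf; elim: l => [|i l IH].
  by under eq_fun do rewrite big_nil; exact: bmeas_cst.
by under eq_fun do rewrite big_cons; exact: bmeasD.
Qed.

Lemma bmeas_poi (R : realType) (a b c : R) (k : nat) :
  0 <= a -> 0 <= c -> bmeas a b (fun x => poi_pmf (c * x) k).
Proof.
move=> a0 c0; apply: bmeasM; last exact: bmeas_cst.
apply: bmeasM; last by apply: bmeas_exp; apply: bmeasZ; exact: bmeas_id.
split.
  apply: measurableT_comp => //; apply: measurable_funN.
  exact: mulrl_measurable.
exists 1 => x /andP[ax _]; rewrite ger0_norm ?expR_ge0//.
by rewrite -expR0 ler_expR oppr_le0 mulr_ge0// (le_trans a0).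
Qed.

Lemma bmeas_integrable (R : realType) (a b : R) (mu : probability R R) f :
  bmeas a b f -> mu.-integrable `[a, b] (EFin \o f).
Proof.
move=> [mf [C fC]]; apply: measurable_bounded_integrable => //.
- by apply: le_lt_trans (probability_le1 _ _) _ => //; rewrite ltry.
- exact: measurable_funTS.
- exists C; split; first exact: num_real.
  move=> D CD x /=; rewrite in_itv/= => /fC; move=> h; exact: le_trans h (ltW CD).
Qed.

Lemma expect_itvD (R : realType) (a b : R) (mu : probability R R) f g :
  bmeas a b f -> bmeas a b g ->
  expect_itv a b mu (fun x => f x + g x) =
  expect_itv a b mu f + expect_itv a b mu g.
Proof. by move=> mf mg; rewrite /expect_itv RintegralD//; exact: bmeas_integrable. Qed.

Lemma expect_itvZ (R : realType) (a b c : R) (mu : probability R R) f :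
  bmeas a b f ->
  expect_itv a b mu (fun x => c * f x) = c * expect_itv a b mu f.
Proof. by move=> mf; rewrite /expect_itv RintegralZl//; exact: bmeas_integrable. Qed.

Lemma expect_itv_cst (R : realType) (a b c : R) (mu : probability R R) :
  mu [set` `[a, b]] = 1%E -> expect_itv a b mu (fun=> c) = c.
Proof. by move=> mu1; rewrite /expect_itv Rintegral_cst//= mu1 mulr1. Qed.

Lemma expect_itv_le (R : realType) (a b : R) (mu : probability R R) f g :
  bmeas a b f -> bmeas a b g -> (forall x, a <= x <= b -> f x <= g x) ->
  expect_itv a b mu f <= expect_itv a b mu g.
Proof.
move=> mf mg fg; apply: le_Rintegral => //; exact: bmeas_integrable.
Qed.

Lemma expect_itv_ge0 (R : realType) (a b : R) (mu : probability R R) f :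
  (forall x, a <= x <= b -> 0 <= f x) -> 0 <= expect_itv a b mu f.
Proof. by move=> f0; apply: Rintegral_ge0 => x /=; rewrite in_itv; exact: f0. Qed.

Lemma expect_itv_sum (R : realType) (a b : R) (mu : probability R R)
    (I : Type) (l : seq I) (f : I -> R -> R) :
  (forall i, bmeas a b (f i)) ->
  expect_itv a b mu (fun x => \sum_(i <- l) f i x) =
  \sum_(i <- l) expect_itv a b mu (f i).
Proof.
move=> mf; elim: l => [|i l IH].
  rewrite big_nil; under [X in expect_itv _ _ _ X]eq_fun do rewrite big_nil.
  by rewrite /expect_itv Rintegral_cst//= mul0r.
rewrite big_cons -IH; under [X in expect_itv _ _ _ X]eq_fun do rewrite big_cons.
by rewrite expect_itvD//; exact: bmeas_sum.
Qed.

(** The complement of [a, b] is a null set, so [f] and its restriction to [a, b] agree almost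
    everywhere. *)
Lemma integral_expect_itv (R : realType) (a b : R) (mu : probability R R)
    (f : R -> R) :
  mu [set` `[a, b]] = 1%E -> bmeas a b f ->
  (\int[mu]_x (f x)%:E)%E = (expect_itv a b mu f)%:E.
Proof.
move=> mu1 mf.
have muC : mu (~` [set` `[a, b]]) = 0%E.
  by rewrite probability_setC// mu1 subee.
rewrite /expect_itv /Rintegral fineK; last first.
  exact/integrable_fin_num/bmeas_integrable.
rewrite [RHS]integral_mkcond; apply: ae_eq_integral => //.
- apply/measurable_EFinP; exact: mf.1.
- apply/(measurable_restrictT (EFin \o f)) => //.
  by apply/measurable_funTS/measurable_EFinP; exact: mf.1.
- exists (~` [set` `[a, b]]); split => //; first exact: measurableC.
  move=> x /= nxab xab; apply: nxab => _.
  by rewrite patchE mem_set.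
Qed.

(** * Symbol counts of words *)

Definition fcons (T : Type) (N : nat) (x : T) (y : {ffun 'I_N -> T})
  : {ffun 'I_N.+1 -> T} :=
  [ffun i => if unlift ord0 i is Some j then y j else x].

Lemma fcons0 (T : Type) (N : nat) (x : T) (y : {ffun 'I_N -> T}) :
  fcons x y ord0 = x.
Proof. by rewrite ffunE unlift_none. Qed.

Lemma fconsS (T : Type) (N : nat) (x : T) (y : {ffun 'I_N -> T}) i :
  fcons x y (lift ord0 i) = y i.
Proof. by rewrite ffunE liftK. Qed.

Lemma big_fcons (R : nmodType) (T : finType) (N : nat)
    (G : {ffun 'I_N.+1 -> T} -> R) :
  \sum_y G y = \sum_(x : T) \sum_(y : {ffun 'I_N -> T}) G (fcons x y).
Proof.
rewrite pair_big/=.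
rewrite (reindex (fun p : T * {ffun 'I_N -> T} => fcons p.1 p.2)) //=.
exists (fun y => (y ord0, [ffun i => y (lift ord0 i)])) => [[x y] _|y _] /=.
  by rewrite fcons0; congr (_, _); apply/ffunP => i; rewrite ffunE fconsS.
apply/ffunP => i; case: (unliftP ord0 i) => [j ->|->].
  by rewrite fconsS ffunE.
by rewrite fcons0.
Qed.

(** Summing out each of the first [r] letters yields one factor [\sum_i p i]. The weights are not
    normalized, so that [p] can be the vector of Poisson rates. *)
Lemma marginal_tail (R : comRingType) (n s r : nat) (p : 'I_n -> R)
    (T : {ffun 'I_s -> 'I_n} -> R) :
  \sum_(y : {ffun 'I_(r + s) -> 'I_n})
     (\prod_i p (y i)) * T [ffun i => y (rshift r i)] =
  (\sum_i p i) ^+ r * \sum_(x : {ffun 'I_s -> 'I_n}) (\prod_i p (x i)) * T x.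
Proof.
elim: r => [|r IH].
  rewrite expr0 mul1r; apply: eq_bigr => y _; congr (_ * T _).
  by apply/ffunP => i; rewrite ffunE; congr (y _); apply/val_inj.
rewrite (@big_fcons _ _ (r + s)) exprS -mulrA -IH mulr_suml.
apply: eq_bigr => x _; rewrite mulr_sumr; apply: eq_bigr => y _.
rewrite big_ord_recl fcons0 -mulrA; congr (_ * (_ * T _)).
  by apply: eq_bigr => i _; rewrite fconsS.
apply/ffunP => i; rewrite !ffunE.
have -> : rshift r.+1 i = lift ord0 (rshift r i) by apply/val_inj.
by rewrite liftK.
Qed.

Definition cnt (n N : nat) (y : {ffun 'I_N -> 'I_n}) (j : 'I_n) : nat :=
  (\sum_i (y i == j))%N.

Lemma cnt_fcons (n N : nat) (x : 'I_n) (y : {ffun 'I_N -> 'I_n}) j :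
  cnt (fcons x y) j = ((x == j) + cnt y j)%N.
Proof.
rewrite /cnt big_ord_recl fcons0; congr (_ + _)%N.
by apply: eq_bigr => i _; rewrite fconsS.
Qed.

Lemma sum_cnt (n N : nat) (y : {ffun 'I_N -> 'I_n}) :
  (\sum_j cnt y j)%N = N.
Proof.
rewrite exchange_big/= -[RHS]card_ord -sum1_card; apply: eq_bigr => i _.
by rewrite (bigD1 (y i)) //= eqxx big1 // => j /negPf; rewrite eq_sym => ->.
Qed.

Lemma prod_cnt (R : comRingType) (n N : nat) (y : {ffun 'I_N -> 'I_n})
    (u : 'I_n -> R) :
  \prod_i u (y i) = \prod_j u j ^+ cnt y j.
Proof.
under [RHS]eq_bigr do rewrite -prodrXr.
rewrite exchange_big/=; apply: eq_bigr => i _.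
rewrite (bigD1 (y i)) //= eqxx expr1 big1 ?mulr1// => j /negPf.
by rewrite eq_sym => ->; rewrite expr0.
Qed.

(** Multinomial bound, by induction on the first letter [x]: the rest of the word has counts [c]
    lowered by one at [x], which splits a factor [c x] off the factorials, and these factors add up
    to [N.+1]. If [c] does not sum to [N], no word is counted. *)
Lemma card_cnt_le (n N : nat) (c : 'I_n -> nat) :
  ((\sum_(y : {ffun 'I_N -> 'I_n}) [forall j, cnt y j == c j])
    * \prod_j (c j)`! <= N`!)%N.
Proof.
have [sc|sc] := eqVneq (\sum_j c j)%N N; last first.
  rewrite big1 // => y _; case: forallP => // yc; case/eqP: sc.
  by rewrite -[RHS](sum_cnt y); apply: eq_bigr => j _; rewrite (eqP (yc j)).
elim: N c sc => [|N IH] c sc.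
  rewrite [X in (_ * X)%N]big1 => [|j _]; last first.
    move/eqP: sc; rewrite sum_nat_eq0 => /forallP/(_ j)/=.
    by move=> /eqP ->.
  rewrite muln1; apply: (@leq_trans (\sum_(y : {ffun 'I_0 -> 'I_n}) 1)%N).
    by apply: leq_sum => y _; case: forallP.
  by rewrite sum1_card card_ffun !card_ord expn0.
have -> : (N.+1`! = (\sum_j c j) * N`!)%N by rewrite factS sc.
rewrite (@big_fcons _ _ N) !big_distrl/=.
apply: leq_sum => x _; have [cx0|cx0] := eqVneq (c x) 0%N.
  rewrite big1 // => y _; case: forallP => // /(_ x).
  by rewrite cnt_fcons eqxx cx0.
(* The truncated subtraction is exact because [c x] is nonzero in this branch. *)
pose c' j := (c j - (x == j))%N.
have cE j : c j = ((x == j) + c' j)%N.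
  by rewrite /c'; case: eqVneq => [<-|_]; rewrite ?subn0// add1n subn1 prednK// lt0n.
have -> : (\prod_j (c j)`! = c x * \prod_j (c' j)`!)%N.
  rewrite (bigD1 x) //= [X in (_ = _ * X)%N](bigD1 x) //= mulnA; congr (_ * _)%N.
    by rewrite [in LHS]cE [in RHS]cE eqxx add1n factS.
  by apply: eq_bigr => j; rewrite eq_sym => /negPf xj; rewrite cE xj.
rewrite mulnCA leq_mul2l; apply/orP; right.
apply: leq_trans (IH c' _); last first.
  by apply/eqP; rewrite -eqSS -sc (bigD1 x) // [in X in _ == X](bigD1 x) //=
    [c x]cE eqxx add1n addSn eqSS; apply/eqP; congr (_ + _)%N;
    apply: eq_bigr => j; rewrite eq_sym => /negPf xj; rewrite cE xj.
rewrite leq_mul2r; apply/orP; right; apply: leq_sum => y _.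
case: (boolP [forall j, cnt (fcons x y) j == c j]) => // /forallP yc.
suff -> : [forall j, cnt y j == c' j] by [].
apply/forallP => j.
by rewrite -(eqn_add2l (x == j)) -cE -cnt_fcons; exact: yc.
Qed.

(** Expand the right side over count vectors [c]. On the left, words with counts [c] occur only for
    [N = \sum_j c j], and there the multinomial bound gives them total weight at most one. *)
Lemma sum_cnt_le (R : realFieldType) (n K : nat) (h : 'I_n -> nat -> R) :
  (forall j k, 0 <= h j k) ->
  \sum_(N < K) \sum_(y : {ffun 'I_N -> 'I_n})
    (\prod_j ((cnt y j)`!%:R * h j (cnt y j))) / N`!%:R <=
  \prod_j \sum_(k < K) h j k.
Proof.
move=> h0; rewrite bigA_distr_bigA/=.
pose A N (c : {ffun 'I_n -> 'I_K}) :=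
  (\sum_(y : {ffun 'I_N -> 'I_n}) [forall j, cnt y j == c j])%N.
have -> : \sum_(N < K) \sum_(y : {ffun 'I_N -> 'I_n})
    (\prod_j ((cnt y j)`!%:R * h j (cnt y j))) / N`!%:R =
  \sum_(c : {ffun 'I_n -> 'I_K}) \sum_(N < K)
     (A N c * \prod_j (c j)`!)%:R / N`!%:R * \prod_j h j (c j).
  rewrite [RHS]exchange_big/=; apply: eq_bigr => N _.
  rewrite /A; under [RHS]eq_bigr do rewrite big_distrl/= natr_sum 2!mulr_suml.
  rewrite exchange_big/=; apply: eq_bigr => y _.
  have yK j : (cnt y j < K)%N.
    by apply: leq_ltn_trans (ltn_ord N); rewrite -[X in (_ <= X)%N](sum_cnt y)
      (bigD1 j) //= leq_addr.
  (* The count vector of [y] is the only one to which [y] contributes; its entries are at most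
     [N < K]. *)
  pose c : {ffun 'I_n -> 'I_K} := [ffun j => Ordinal (yK j)].
  rewrite (bigD1 c) //= [X in _ + X]big1 ?addr0 => [|d dc]; last first.
    case: forallP => [yd|_]; last by rewrite !mul0n !mul0r.
    case/eqP: dc; apply/ffunP => j; apply/val_inj; rewrite ffunE/=.
    by rewrite (eqP (yd j)).
  have -> : [forall j, cnt y j == c j] by apply/forallP => j; rewrite ffunE.
  rewrite mul1n big_split/= natr_prod [RHS]mulrAC.
  by congr (_ * _ / _); apply: eq_bigr => j _; rewrite ffunE.
apply: ler_sum => c _; rewrite -mulr_suml -[leRHS]mul1r ler_wpM2r ?prodr_ge0//.
have [cK|cK] := ltnP (\sum_j c j)%N K.
  rewrite (bigD1 (Ordinal cK)) //= [X in _ + X]big1 ?addr0 => [|N NK]; last first.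
    rewrite /A big1 ?mul0n ?mul0r // => y _; case: forallP => // yc.
    case/eqP: NK; apply/val_inj; rewrite /= -(sum_cnt y).
    by apply: eq_bigr => j _; rewrite (eqP (yc j)).
  by rewrite ler_pdivrMr ?ltr0n ?fact_gt0// mul1r ler_nat card_cnt_le.
rewrite big1 ?ler01// => N _; rewrite /A big1 ?mul0n ?mul0r // => y _.
case: forallP => // yc; move: cK; rewrite leqNgt => /negP[].
by rewrite -(eq_bigr _ (fun j _ => eqP (yc j))) sum_cnt.
Qed.

(** * Hybrid bound for products of laws *)

Lemma prodr_le1 (R : realFieldType) (I : Type) (r : seq I) (P : pred I) (F : I -> R) :
  (forall i, P i -> 0 <= F i <= 1) -> \prod_(i <- r | P i) F i <= 1.
Proof.
move=> F01; apply: (@le_trans _ _ (\prod_(i <- r | P i) 1)); last by rewrite big1.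
exact: ler_prod.
Qed.

(* Hybrid argument: the coordinates are switched from [q] to [p] one by one. *)
Lemma norm_prod_sub_le (R : realFieldType) (n : nat) (p q : 'I_n -> R) :
  (forall j, 0 <= p j) -> (forall j, 0 <= q j) ->
  `|\prod_j p j - \prod_j q j| <=
  \sum_(i < n) \prod_(j < n) (if (j < i)%N then p j else if j == i then `|p j - q j| else q j).
Proof.
elim: n p q => [|n IH] p q p0 q0.
  by rewrite !big_ord0 subrr normr0.
rewrite !big_ord_recl.
have -> : p ord0 * \prod_i p (lift ord0 i) - q ord0 * \prod_i q (lift ord0 i) =
  (p ord0 - q ord0) * \prod_i q (lift ord0 i) +
  p ord0 * (\prod_i p (lift ord0 i) - \prod_i q (lift ord0 i)) by ring.
apply: le_trans (ler_normD _ _) _; apply: lerD.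
  by rewrite /= normrM ler_wpM2l // ger0_norm ?prodr_ge0//.
apply: (@le_trans _ _ (p ord0 * `|\prod_i p (lift ord0 i) - \prod_i q (lift ord0 i)|)).
  by rewrite normrM ger0_norm.
have := IH (fun j => p (lift ord0 j)) (fun j => q (lift ord0 j)) (fun=> p0 _) (fun=> q0 _).
move=> /(ler_wpM2l (p0 ord0)) /le_trans; apply.
rewrite mulr_sumr; apply: ler_sum => i _.
rewrite big_ord_recl /= .
by [].
Qed.

(** Subadditivity of l1 distance over independent coordinates, stated on words. [sum_cnt_le] turns
    the i-th hybrid into a product of one-coordinate sums: the i-th factor is the l1 distance of [p]
    and [q], the others are at most one. *)
Lemma hybrid_bound (R : realFieldType) (n K : nat) (p q : nat -> R) :
  (forall k, 0 <= p k) -> (forall k, 0 <= q k) ->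
  \sum_(k < K) p k <= 1 -> \sum_(k < K) q k <= 1 ->
  \sum_(N < K) \sum_(y : {ffun 'I_N -> 'I_n})
    (\prod_j (cnt y j)`!%:R) / N`!%:R *
     `|\prod_j p (cnt y j) - \prod_j q (cnt y j)| <=
  n%:R * \sum_(k < K) `|p k - q k|.
Proof.
move=> p0 q0 sp sq.
pose h (i j : 'I_n) k :=
  if (j < i)%N then p k else if j == i then `|p k - q k| else q k.
have h0 i j k : 0 <= h i j k by rewrite /h; case: ifP => // _; case: ifP.
apply: (@le_trans _ _ (\sum_(i < n) \prod_j \sum_(k < K) h i j k)).
  apply: le_trans (ler_sum _ (fun i _ => sum_cnt_le _ (h0 i))).
  rewrite exchange_big/=; apply: ler_sum => N _.
  rewrite exchange_big/=; apply: ler_sum => y _.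
  under [leRHS]eq_bigr do rewrite big_split/= mulrAC.
  rewrite -mulr_sumr ler_wpM2l//; last exact: norm_prod_sub_le.
  by rewrite divr_ge0// prodr_ge0.
rewrite -[n in n%:R]card_ord -sumr_const mulr_suml; apply: ler_sum => i _.
rewrite mul1r (bigD1 i) //= {1}/h ltnn eqxx -[leRHS]mulr1 ler_wpM2l//.
  exact: sumr_ge0.
apply: prodr_le1 => j ji; rewrite sumr_ge0//= /h (negPf ji).
by case: (j < i)%N.
Qed.

(** * Concentration of the Poisson law *)

Lemma poi_pmf_ge0 (R : realType) (lam : R) (k : nat) :
  0 <= lam -> 0 <= poi_pmf lam k.
Proof.
by move=> lam0; rewrite divr_ge0 ?ler0n// mulr_ge0 ?expR_ge0 ?exprn_ge0.
Qed.

Lemma poi_pmfS (R : realType) (lam : R) (k : nat) :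
  poi_pmf lam k.+1 = lam / k.+1%:R * poi_pmf lam k.
Proof.
rewrite /poi_pmf factS natrM exprS; field.
by rewrite nat1r !pnatr_eq0 -lt0n fact_gt0.
Qed.

Lemma cvg_sum_poi (R : realType) (lam : R) :
  (fun K : nat => \sum_(0 <= k < K) poi_pmf lam k) @ \oo --> (1 : R).
Proof.
rewrite -(expRxMexpNx_1 lam) mulrC.
have -> : (fun K : nat => \sum_(0 <= k < K) poi_pmf lam k) =
    (fun K => expR (- lam) * series (exp_coeff lam) K).
  apply/funext => K; rewrite /series/= mulr_sumr; apply: eq_bigr => k _.
  by rewrite /exp_coeff/= mulrA.
by apply: cvgMr; exact: is_cvg_series_exp_coeff.
Qed.

Lemma sum_poi_le1 (R : realType) (lam : R) (K : nat) :
  0 <= lam -> \sum_(0 <= k < K) poi_pmf lam k <= 1.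
Proof.
move=> lam0; have cv := @cvg_sum_poi R lam.
rewrite -(cvg_lim (@Rhausdorff R) cv).
apply: (@nondecreasing_cvgn_le R (fun K => \sum_(0 <= k < K) poi_pmf lam k)).
  apply/nondecreasing_seqP => k; rewrite big_nat_recr//= lerDl.
  exact: poi_pmf_ge0.
by apply/cvg_ex; exists 1.
Qed.

(** Write (k - lam)^2 = k(k-1) + (1 - 2 lam) k + lam^2; the factors k(k-1) and k shift the Poisson
    weights by two and by one, hence the three truncation points. In the limit this is the variance
    [lam]. *)
Lemma poi_second_moment (R : realType) (lam : R) (K : nat) :
  \sum_(0 <= k < K.+2) poi_pmf lam k * (k%:R - lam) ^+ 2 =
  lam ^+ 2 * (\sum_(0 <= k < K) poi_pmf lam k) +
  (1 - 2 * lam) * lam * (\sum_(0 <= k < K.+1) poi_pmf lam k) +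
  lam ^+ 2 * (\sum_(0 <= k < K.+2) poi_pmf lam k).
Proof.
elim: K => [|K IH].
  by rewrite !(big_nat_recr, big_geq)//= poi_pmfS; field.
have E k : \sum_(0 <= i < k.+1) poi_pmf lam i =
    \sum_(0 <= i < k) poi_pmf lam i + poi_pmf lam k by rewrite big_nat_recr.
rewrite big_nat_recr//= IH !E !poi_pmfS.
rewrite -[K.+2%:R]natr1 -[K.+1%:R]natr1; field.
by rewrite !natr1 !pnatr_eq0.
Qed.

(** The function 1 - (k - lam)^2 / D^2 is at most 1, and it is nonpositive outside the window [s, M
    + s), so its Poisson mean, which is 1 - lam / D^2, is at most the mass of the window. *)
Lemma poi_chebyshev (R : realType) (lam D : R) (s M : nat) :
  0 <= lam -> 0 < D -> s%:R <= lam - D -> lam + D <= (M + s)%:R ->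
  1 - lam / D ^+ 2 <= \sum_(r < M) poi_pmf lam (r + s).
Proof.
move=> lam0 D0 sD MD.
pose A K := \sum_(0 <= k < K) poi_pmf lam k.
(* The truncated mean of 1 - (k - lam)^2 / D^2, already in the form given by [poi_second_moment] so
   that its limit can be read off. *)
pose u K := A K.+2 - (lam ^+ 2 * A K + (1 - 2 * lam) * lam * A K.+1 +
  lam ^+ 2 * A K.+2) / D ^+ 2.
have A0 : A @ \oo --> (1 : R) by exact: cvg_sum_poi.
have A1 : (fun K => A K.+1) @ \oo --> (1 : R) by rewrite (cvg_shiftS A).
have A2 : (fun K => A K.+2) @ \oo --> (1 : R).
  by rewrite (cvg_shiftS (fun K => A K.+1)).
have cu : u @ \oo --> 1 - lam / D ^+ 2.
  have -> : 1 - lam / D ^+ 2 = 1 - (lam ^+ 2 * 1 + (1 - 2 * lam) * lam * 1 +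
    lam ^+ 2 * 1) / D ^+ 2 by congr (1 - _ / _); ring.
  apply: cvgB => //; apply: cvgMl; apply: cvgD; last exact: cvgMr.
  by apply: cvgD; exact: cvgMr.
rewrite -(cvg_lim (@Rhausdorff R) cu); apply: limr_le.
  by apply/cvg_ex; eexists; exact: cu.
exists (M + s)%N => // K /= MK.
have -> : u K = \sum_(0 <= k < K.+2) poi_pmf lam k * (1 - (k%:R - lam) ^+ 2 / D ^+ 2).
  under eq_bigr do rewrite mulrBr mulr1 mulrA.
  by rewrite big_split/= sumrN -mulr_suml poi_second_moment.
(* Split the range below [s], inside the window and beyond it; the outer two sums are
   nonpositive. *)
rewrite (big_cat_nat (n := s)) //=; last by apply: leq_trans (leq_addl M s) _; rewrite ltnW// ltnW.
rewrite (big_cat_nat (n := M + s) (m := s)) /= ?leq_addl//; last by rewrite ltnW// ltnW.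
have D20 : 0 < D ^+ 2 by rewrite exprn_gt0.
have neg k : D <= `|k%:R - lam| ->
    poi_pmf lam k * (1 - (k%:R - lam) ^+ 2 / D ^+ 2) <= 0.
  move=> Dk; rewrite mulr_ge0_le0 ?poi_pmf_ge0// subr_le0 ler_pdivlMr// mul1r.
  by rewrite -[leRHS]real_normK ?num_real// lerXn2r ?nnegrE// ltW.
have -> : \sum_(r < M) poi_pmf lam (r + s) = \sum_(s <= k < M + s) poi_pmf lam k.
  by rewrite -[in RHS](add0n s) big_addn add0n addnK big_mkord.
rewrite -[leRHS]add0r -[leRHS]addr0 -[leRHS]addrA; apply: lerD.
  rewrite big_nat_cond; apply: sumr_le0 => k /andP[/andP[_ ks] _].
  apply: neg; have : (k%:R : R) <= s%:R by rewrite ler_nat ltnW.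
  by move=> ksR; rewrite ler0_norm; lra.
apply: lerD.
  apply: ler_sum => k _; rewrite -[leRHS]mulr1 ler_wpM2l ?poi_pmf_ge0//.
  by rewrite gerBl divr_ge0 ?sqr_ge0// ltW.
rewrite big_nat_cond; apply: sumr_le0 => k /andP[/andP[ks _] _].
apply: neg; have : ((M + s)%:R : R) <= k%:R by rewrite ler_nat.
by move=> ksR; rewrite ger0_norm; lra.
Qed.

(** * Expectations over independent coordinates *)

(* [has_expect a b mu Phi v]: [Phi] is a finite sum of products of one-variable
   functions and [v] is its expectation when the coordinates are i.i.d. with
   law [mu]; this avoids constructing the product measure. *)
Definition has_expect (R : realType) (n : nat) (a b : R) (mu : probability R R)
  (Phi : ('I_n -> R) -> R) (v : R) : Prop :=
  exists (I : finType) (c : I -> R) (f : I -> 'I_n -> R -> R),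
    [/\ forall i j, bmeas a b (f i j),
        forall u, Phi u = \sum_i c i * \prod_j f i j (u j) &
        v = \sum_i c i * \prod_j expect_itv a b mu (f i j)].

(** The terms may have either sign, so positivity is not termwise. Induct on [n], integrating out
    one coordinate with the others frozen: the expectation of the first is absorbed into the
    coefficients. *)
Lemma sum_prod_expect_ge0 (R : realType) (n : nat) (a b : R)
    (mu : probability R R) (I : finType) (c : I -> R) (f : I -> 'I_n -> R -> R) :
  (forall i j, bmeas a b (f i j)) ->
  (forall u : 'I_n -> R, (forall j, a <= u j <= b) ->
     0 <= \sum_i c i * \prod_j f i j (u j)) ->
  0 <= \sum_i c i * \prod_j expect_itv a b mu (f i j).
Proof.
elim: n c f => [|n IH] c f mf pos.
  have /pos : forall j : 'I_0, a <= (fun=> a) j <= b by case.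
  by congr (_ <= _); apply: eq_bigr => i _; rewrite !big_ord0.
under eq_bigr do rewrite big_ord_recl mulrA.
apply: (IH (fun i => c i * expect_itv a b mu (f i ord0))
           (fun i j => f i (lift ord0 j))) => [i j|u uab]; first exact: mf.
have -> : \sum_i c i * expect_itv a b mu (f i ord0) * \prod_j f i (lift ord0 j) (u j)
  = expect_itv a b mu
      (fun x => \sum_i (c i * \prod_j f i (lift ord0 j) (u j)) * f i ord0 x).
  rewrite expect_itv_sum => [|i]; last exact: bmeasZ.
  by apply: eq_bigr => i _; rewrite expect_itvZ// mulrAC.
apply: expect_itv_ge0 => x xab.
pose w j := if unlift ord0 j is Some j' then u j' else x.
have /pos : forall j, a <= w j <= b by move=> j; rewrite /w; case: unlift.
congr (_ <= _); apply: eq_bigr => i _; rewrite big_ord_recl /w unlift_none.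
rewrite mulrA mulrAC; congr (_ * _ * _).
by apply: eq_bigr => j _; rewrite liftK.
Qed.

Lemma has_expectD (R : realType) (n : nat) (a b : R) (mu : probability R R)
    (Phi Psi : ('I_n -> R) -> R) (v w : R) :
  has_expect a b mu Phi v -> has_expect a b mu Psi w ->
  has_expect a b mu (fun u => Phi u + Psi u) (v + w).
Proof.
move=> [I [c [f [mf Phif ->]]]] [J [d [g [mg Psig ->]]]].
exists (I + J)%type, (fun k => match k with inl i => c i | inr j => d j end),
  (fun k => match k with inl i => f i | inr j => g j end); split.
- by case.
- by move=> u; rewrite big_sumType/= Phif Psig.
- by rewrite big_sumType.
Qed.

Lemma has_expectZ (R : realType) (n : nat) (a b e : R) (mu : probability R R)
    (Phi : ('I_n -> R) -> R) (v : R) :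
  has_expect a b mu Phi v -> has_expect a b mu (fun u => e * Phi u) (e * v).
Proof.
move=> [I [c [f [mf Phif ->]]]]; exists I, (fun i => e * c i), f; split => //.
- by move=> u; rewrite Phif mulr_sumr; apply: eq_bigr => i _; rewrite mulrA.
- by rewrite mulr_sumr; apply: eq_bigr => i _; rewrite mulrA.
Qed.

Lemma has_expect_sum (R : realType) (n : nat) (a b : R) (mu : probability R R)
    (J : Type) (l : seq J) (Phi : J -> ('I_n -> R) -> R) (v : J -> R) :
  (forall j, has_expect a b mu (Phi j) (v j)) ->
  has_expect a b mu (fun u => \sum_(j <- l) Phi j u) (\sum_(j <- l) v j).
Proof.
move=> Phiv; elim: l => [|j l IH].
  exists 'I_0, (fun=> 0), (fun _ _ _ => 0); split.
  - by case.
  - by move=> u; rewrite big_nil big_ord0.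
  - by rewrite big_nil big_ord0.
under eq_fun do rewrite big_cons.
by rewrite big_cons; exact: has_expectD.
Qed.

Lemma has_expect_prod (R : realType) (n : nat) (a b : R) (mu : probability R R)
    (f : 'I_n -> R -> R) :
  (forall j, bmeas a b (f j)) ->
  has_expect a b mu (fun u => \prod_j f j (u j))
    (\prod_j expect_itv a b mu (f j)).
Proof.
move=> mf; exists 'I_1, (fun=> 1), (fun=> f); split => //.
- by move=> u; rewrite big_ord1 mul1r.
- by rewrite big_ord1 mul1r.
Qed.

Lemma has_expect_cst (R : realType) (n : nat) (a b c : R) (mu : probability R R) :
  mu [set` `[a, b]] = 1%E ->
  has_expect a b mu (fun _ : 'I_n -> R => c) c.
Proof.
move=> mu1; exists 'I_1, (fun=> c), (fun _ _ => cst 1); split.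
- by move=> *; exact: bmeas_cst.
- by move=> u; rewrite big_ord1 big1 ?mulr1.
- by rewrite big_ord1 big1 ?mulr1// => j _; rewrite expect_itv_cst.
Qed.

Lemma has_expect_coord (R : realType) (n : nat) (a b : R) (mu : probability R R)
    (f : R -> R) (j : 'I_n) :
  mu [set` `[a, b]] = 1%E -> bmeas a b f ->
  has_expect a b mu (fun u => f (u j)) (expect_itv a b mu f).
Proof.
move=> mu1 mf.
have := @has_expect_prod R n a b mu (fun k => if k == j then f else cst 1).
have -> : (fun u => \prod_(k < n) (if k == j then f else cst 1) (u k)) =
    (fun u => f (u j)).
  apply/funext => u; rewrite (bigD1 j) //= eqxx big1 ?mulr1// => k /negPf -> //.
have -> : \prod_(k < n) expect_itv a b mu (if k == j then f else cst 1) =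
    expect_itv a b mu f.
  rewrite (bigD1 j) //= eqxx big1 ?mulr1// => k /negPf ->.
  exact: expect_itv_cst.
by apply => k; case: ifP => // _; exact: bmeas_cst.
Qed.

(** Coefficients may be negative, so [Psi - Phi] is represented too and positivity on the cube
    applies. *)
Lemma has_expect_le (R : realType) (n : nat) (a b : R) (mu : probability R R)
    (Phi Psi : ('I_n -> R) -> R) (v w : R) :
  has_expect a b mu Phi v -> has_expect a b mu Psi w ->
  (forall u, (forall j, a <= u j <= b) -> Phi u <= Psi u) -> v <= w.
Proof.
move=> Phiv Psiw le; rewrite -subr_ge0 -mulN1r.
have [I [c [f [mf PPf ->]]]] := has_expectD Psiw (has_expectZ (-1) Phiv).
apply: sum_prod_expect_ge0 => // u uab.
by rewrite -PPf mulN1r subr_ge0 le.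
Qed.

(** Variance of an i.i.d. sum: after expanding the square, the cross terms have expectation zero
    because [f] is centred. *)
Lemma has_expect_sqr (R : realType) (n : nat) (a b : R) (mu : probability R R)
    (f : R -> R) :
  mu [set` `[a, b]] = 1%E -> bmeas a b f -> expect_itv a b mu f = 0 ->
  has_expect a b mu (fun u : 'I_n -> R => (\sum_j f (u j)) ^+ 2)
    (n%:R * expect_itv a b mu (fun x => f x ^+ 2)).
Proof.
move=> mu1 mf f0.
have -> : (fun u : 'I_n -> R => (\sum_j f (u j)) ^+ 2) =
    (fun u => \sum_i \sum_j f (u i) * f (u j)).
  apply/funext => u; rewrite expr2 mulr_suml; apply: eq_bigr => i _.
  by rewrite mulr_sumr.
have -> : n%:R * expect_itv a b mu (fun x => f x ^+ 2) =
    \sum_(i < n) \sum_(j < n) (if i == j then expect_itv a b mu (fun x => f x ^+ 2) else 0).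
  rewrite -[n in n%:R]card_ord -sumr_const mulr_suml; apply: eq_bigr => i _.
  rewrite mul1r (bigD1 i) //= eqxx big1 ?addr0// => j.
  by rewrite eq_sym => /negPf ->.
apply: has_expect_sum => i; apply: has_expect_sum => j.
case: eqVneq => [<-|ij].
  apply: (@has_expect_coord _ _ _ _ _ (fun x => f x ^+ 2)) => //.
  exact: bmeas_exp.
have := @has_expect_prod R n a b mu
  (fun k => if (k == i) || (k == j) then f else cst 1).
have -> : (fun u => \prod_(k < n) (if (k == i) || (k == j) then f else cst 1) (u k)) =
    (fun u => f (u i) * f (u j)).
  apply/funext => u; rewrite (bigD1 i) //= eqxx/=; congr (_ * _).
  rewrite (bigD1 j) 1?eq_sym//= eqxx orbT big1 ?mulr1//.
  by move=> k /andP[/negPf -> /negPf ->].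
rewrite [\prod_(k < n) _](bigD1 i) //= eqxx/= f0 mul0r.
by apply => k; case: ifP => // _; exact: bmeas_cst.
Qed.

(** * Poissonized testers *)

(** The quotient of factorials is the inverse multinomial coefficient, that is the probability of
    the ordering [y] given its counts. Length [r + s] guarantees that [s] letters are available to
    read. *)
Definition prob_close_given (R : realType) (n s r : nat)
  (T : {ffun 'I_s -> 'I_n} -> R) (y : {ffun 'I_(r + s) -> 'I_n}) : R :=
  (\prod_j (cnt y j)`!%:R) / (r + s)`!%:R * T [ffun i => y (rshift r i)].

(* Closeness probability of the tester when the count of each symbol [j] is an
   independent Poisson variable with mean [m * u j], restricted to totals in
   [s, M + s): given its counts, the sample is a uniformly random ordering, and
   the tester reads its last [s] entries. *)
Definition poissonized (R : realType) (n s : nat) (m M : nat)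
  (T : {ffun 'I_s -> 'I_n} -> R) (u : 'I_n -> R) : R :=
  \sum_(r < M) \sum_(y : {ffun 'I_(r + s) -> 'I_n})
    prob_close_given T y * \prod_j poi_pmf (m%:R * u j) (cnt y j).

(** The factorials of the Poisson weights cancel those of [prob_close_given], leaving the product of
    rates along the word; [marginal_tail] then sums out the unread letters. *)
Lemma poissonizedE (R : realType) (n s m M : nat)
    (T : {ffun 'I_s -> 'I_n} -> R) (u : 'I_n -> R) :
  poissonized m M T u =
  \sum_(r < M) expR (- (m%:R * \sum_j u j)) / (r + s)`!%:R *
    (m%:R * \sum_j u j) ^+ r *
    (\sum_(x : {ffun 'I_s -> 'I_n}) (\prod_i (m%:R * u (x i))) * T x).
Proof.
set lam := m%:R * \sum_j u j.
have lamE : \sum_j m%:R * u j = lam by rewrite /lam mulr_sumr.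
have expE : expR (- lam) = \prod_j expR (- (m%:R * u j)).
  by rewrite -lamE -sumrN expR_sum.
apply: eq_bigr => r _; rewrite -mulrA -lamE.
rewrite -(@marginal_tail _ n s r (fun j => m%:R * u j)) lamE mulr_sumr.
apply: eq_bigr => y _.
rewrite (@prod_cnt _ n _ y (fun j => m%:R * u j)) /prob_close_given /poi_pmf.
rewrite expE !big_split/= prodfV; field; rewrite pnatr_eq0 -lt0n fact_gt0/=.
by apply/prodf_neq0 => j _; rewrite pnatr_eq0 -lt0n fact_gt0.
Qed.

Lemma poissonized_ge0 (R : realType) (n s m M : nat)
    (T : {ffun 'I_s -> 'I_n} -> R) (u : 'I_n -> R) :
  is_tester T -> (forall j, 0 <= u j) -> 0 <= poissonized m M T u.
Proof.
move=> TT u0; apply: sumr_ge0 => r _; apply: sumr_ge0 => y _.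
have /andP[T0 _] := TT [ffun i => y (rshift r i)].
rewrite mulr_ge0 ?prodr_ge0// => [|j _]; last by rewrite poi_pmf_ge0// mulr_ge0.
by rewrite mulr_ge0 ?divr_ge0 ?prodr_ge0.
Qed.

Lemma sum_poi_shift_le1 (R : realType) (lam : R) (s M : nat) :
  0 <= lam -> \sum_(r < M) poi_pmf lam (r + s) <= 1.
Proof.
move=> lam0; apply: le_trans (sum_poi_le1 (M + s) lam0).
rewrite (big_cat_nat (n := s)) ?leq_addl//= -[leLHS]add0r lerD//.
  by apply: sumr_ge0 => k _; exact: poi_pmf_ge0.
by rewrite -[in leRHS](add0n s) big_addn add0n addnK big_mkord.
Qed.

(** The total count is Poisson with mean m S, where S is the sum of [u], and given the total the
    letters are i.i.d. from u / S. *)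
Lemma poissonized_prob_close (R : realType) (n s m M : nat)
    (T : {ffun 'I_s -> 'I_n} -> R) (u : 'I_n -> R) :
  \sum_j u j != 0 ->
  poissonized m M T u =
  (\sum_(r < M) poi_pmf (m%:R * \sum_j u j) (r + s)) *
  prob_close T (fun j => u j / \sum_j u j).
Proof.
move=> S0; rewrite poissonizedE mulr_suml; apply: eq_bigr => r _.
have -> : \sum_(x : {ffun 'I_s -> 'I_n}) (\prod_i (m%:R * u (x i))) * T x =
    (m%:R * \sum_j u j) ^+ s * prob_close T (fun j => u j / \sum_j u j).
  rewrite /prob_close mulr_sumr; apply: eq_bigr => x _; rewrite mulrA.
  congr (_ * _); rewrite -[s in _ ^+ s]card_ord -prodr_const -big_split/=.
  by apply: eq_bigr => i _; field.
rewrite /poi_pmf exprD; field.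
by rewrite pnatr_eq0 -lt0n fact_gt0.
Qed.

(** Bounding [T] by one in the unnormalized form covers [\sum_j u j = 0] as well. *)
Lemma poissonized_le1 (R : realType) (n s m M : nat)
    (T : {ffun 'I_s -> 'I_n} -> R) (u : 'I_n -> R) :
  is_tester T -> (forall j, 0 <= u j) -> poissonized m M T u <= 1.
Proof.
move=> TT u0.
have lam0 : 0 <= m%:R * \sum_j u j by rewrite mulr_ge0// sumr_ge0.
apply: le_trans (sum_poi_shift_le1 s M lam0); rewrite poissonizedE.
apply: ler_sum => r _; rewrite /poi_pmf exprD mulrA [leRHS]mulrAC.
rewrite [X in _ <= X * _]mulrAC [leRHS]mulrC [leRHS]mulrC ler_wpM2l//.
  by rewrite mulr_ge0 ?divr_ge0 ?expR_ge0 ?exprn_ge0.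
rewrite mulr_sumr -[s in _ ^+ s]card_ord -prodr_const bigA_distr_bigA/=.
apply: ler_sum => x _; have /andP[T0 T1] := TT x.
by rewrite -[leRHS]mulr1 ler_wpM2l// prodr_ge0// => i _; rewrite mulr_ge0.
Qed.

Lemma prob_close_ge0 (R : realType) (n s : nat)
    (T : {ffun 'I_s -> 'I_n} -> R) (p : 'I_n -> R) :
  is_tester T -> (forall j, 0 <= p j) -> 0 <= prob_close T p.
Proof.
move=> TT p0; apply: sumr_ge0 => x _; have /andP[T0 _] := TT x.
by rewrite mulr_ge0 ?prodr_ge0.
Qed.

(** * Averaging the Poissonized tester over the rates *)

Definition poi_expect (R : realType) (a b : R) (mu : probability R R) (m k : nat)
  : R := expect_itv a b mu (fun x => poi_pmf (m%:R * x) k).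

Definition expect_poissonized (R : realType) (n s : nat) (a b : R)
  (mu : probability R R) (m M : nat) (T : {ffun 'I_s -> 'I_n} -> R) : R :=
  \sum_(r < M) \sum_(y : {ffun 'I_(r + s) -> 'I_n})
    prob_close_given T y * \prod_j poi_expect a b mu m (cnt y j).

Lemma has_expect_poissonized (R : realType) (n s m M : nat) (a b : R)
    (mu : probability R R) (T : {ffun 'I_s -> 'I_n} -> R) :
  0 <= a ->
  has_expect a b mu (poissonized m M T) (expect_poissonized a b mu m M T).
Proof.
move=> a0; apply: has_expect_sum => r; apply: has_expect_sum => y.
apply: has_expectZ.
apply: (@has_expect_prod _ _ _ _ _ (fun j x => poi_pmf (m%:R * x) (cnt y j))) => j.
exact: bmeas_poi.
Qed.

Lemma poi_expect_ge0 (R : realType) (a b : R) (mu : probability R R) (m k : nat) :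
  0 <= a -> 0 <= poi_expect a b mu m k.
Proof.
move=> a0; apply: expect_itv_ge0 => x /andP[ax _].
by rewrite poi_pmf_ge0// mulr_ge0// (le_trans a0).
Qed.

Lemma sum_poi_expect_le1 (R : realType) (a b : R) (mu : probability R R)
    (m K : nat) :
  0 <= a -> mu [set` `[a, b]] = 1%E -> \sum_(k < K) poi_expect a b mu m k <= 1.
Proof.
move=> a0 mu1; rewrite -(big_mkord xpredT (poi_expect a b mu m)).
rewrite -expect_itv_sum => [|k]; last exact: bmeas_poi.
rewrite -[leRHS](expect_itv_cst 1 mu1); apply: expect_itv_le.
- by apply: bmeas_sum => k; exact: bmeas_poi.
- exact: bmeas_cst.
- by move=> x /andP[ax _]; rewrite sum_poi_le1// mulr_ge0// (le_trans a0).
Qed.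

(** A partial sum is below the series of nonnegative terms, and the factor 2 undoes the one-half in
    [tv_nat]. *)
Lemma sum_norm_poi_expect_le (R : realType) (a b : R) (mu mu' : probability R R)
    (m K : nat) (t : R) :
  0 <= a -> mu [set` `[a, b]] = 1%E -> mu' [set` `[a, b]] = 1%E ->
  (tv_nat (poi_mix mu m) (poi_mix mu' m) <= t%:E)%E ->
  \sum_(k < K) `|poi_expect a b mu m k - poi_expect a b mu' m k| <= 2 * t.
Proof.
move=> a0 mu1 mu1'.
have mixE (nu : probability R R) : nu [set` `[a, b]] = 1%E ->
    poi_mix nu m = (fun k => (poi_expect a b nu m k)%:E).
  move=> nu1; apply/funext => k; rewrite /poi_mix (integral_expect_itv nu1)//.
  exact: bmeas_poi.
rewrite /tv_nat !mixE// => tv.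
have : ((2^-1)%:E * \sum_(0 <= k < K)
    `|(poi_expect a b mu m k)%:E - (poi_expect a b mu' m k)%:E| <= t%:E)%E.
  apply: le_trans tv; rewrite lee_pmul2l// ?lte_fin ?invr_gt0//.
  exact: nneseries_lim_ge.
rewrite big_mkord (eq_bigr (fun k : 'I_K =>
  (`|poi_expect a b mu m k - poi_expect a b mu' m k|)%:E)) => //.
by rewrite sumEFin -EFinM lee_fin ler_pdivrMl.
Qed.

(** Only the products of averaged masses depend on the law, and since [T] is at most one their
    weights are at most inverse multinomial coefficients, so [hybrid_bound] applies. *)
Lemma expect_poissonized_sub_le (R : realType) (n s m M : nat) (a b : R)
    (mu mu' : probability R R) (T : {ffun 'I_s -> 'I_n} -> R) (t : R) :
  0 <= a -> mu [set` `[a, b]] = 1%E -> mu' [set` `[a, b]] = 1%E ->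
  (tv_nat (poi_mix mu m) (poi_mix mu' m) <= t%:E)%E -> is_tester T ->
  expect_poissonized a b mu m M T - expect_poissonized a b mu' m M T <=
  n%:R * (2 * t).
Proof.
move=> a0 mu1 mu1' tv TT.
apply: le_trans (ler_wpM2l (ler0n R n) (sum_norm_poi_expect_le (M + s) a0 mu1 mu1' tv)).
apply: le_trans (@hybrid_bound R n (M + s) _ _
  (fun k => poi_expect_ge0 b mu m k a0) (fun k => poi_expect_ge0 b mu' m k a0)
  (sum_poi_expect_le1 m (M + s) a0 mu1) (sum_poi_expect_le1 m (M + s) a0 mu1')).
pose G N : R := \sum_(y : {ffun 'I_N -> 'I_n})
    (\prod_j (cnt y j)`!%:R) / N`!%:R *
     `|\prod_j poi_expect a b mu m (cnt y j) - \prod_j poi_expect a b mu' m (cnt y j)|.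
have G0 N : 0 <= G N.
  by apply: sumr_ge0 => y _; rewrite mulr_ge0// divr_ge0// prodr_ge0.
(* Word lengths below [s] occur only in the upper bound and contribute nonnegative terms. *)
rewrite -/(G _) -(big_mkord xpredT G) (big_cat_nat (n := s)) ?leq_addl//=.
rewrite -[leLHS]add0r lerD ?sumr_ge0//.
rewrite -[in leRHS](add0n s) big_addn add0n addnK big_mkord.
rewrite -sumrB; apply: ler_sum => r _; rewrite -sumrB; apply: ler_sum => y _.
rewrite -mulrBr; apply: le_trans (ler_norm _) _; rewrite normrM ler_wpM2r//.
have /andP[T0 T1] := TT [ffun i => y (rshift r i)].
rewrite ger0_norm /prob_close_given; last by rewrite mulr_ge0 ?divr_ge0 ?prodr_ge0.
by rewrite -[leRHS]mulr1 ler_wpM2l// divr_ge0// prodr_ge0.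
Qed.

(** * Closeness and farness of the random distribution *)

Lemma sum_ord_const (R : pzSemiRingType) (n : nat) (x : R) :
  \sum_(j < n) x = n%:R * x.
Proof. by rewrite sumr_const card_ord mulr_natl. Qed.

(** Each coordinate satisfies S (u_j / S - 1/n) - (u_j - 1/n) = -(S - 1)/n, and there are [n] of
    them. *)
Lemma l1_unif_normalized (R : realType) (n : nat) (u : 'I_n -> R) (S : R) :
  (0 < n)%N -> 0 < S ->
  `|S * l1_unif (fun j => u j / S) - \sum_j `|u j - n%:R^-1| | <= `|S - 1|.
Proof.
move=> n0 S0.
rewrite /l1_unif mulr_sumr -sumrB; apply: le_trans (ler_norm_sum _ _ _) _.
apply: (@le_trans _ _ (\sum_(j < n) `|S - 1| / n%:R)); last first.
  by rewrite sum_ord_const mulrC mulfVK// pnatr_eq0 -lt0n.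
apply: ler_sum => j _.
rewrite -[X in X * _]gtr0_norm// -normrM; apply: le_trans (ler_dist_dist _ _) _.
rewrite -[n%:R in leRHS]ger0_norm// -normf_div.
have -> : S * (u j / S - n%:R^-1) - (u j - n%:R^-1) = - ((S - 1) / n%:R).
  by field; rewrite pnatr_eq0 -lt0n n0 gt_eqF.
by rewrite normrN.
Qed.

Lemma is_distr_normalized (R : realType) (n : nat) (u : 'I_n -> R) :
  (forall j, 0 <= u j) -> 0 < \sum_j u j ->
  is_distr (fun j => u j / \sum_j u j).
Proof.
move=> u0 S0; split=> [j|]; first by rewrite divr_ge0// ltW.
by rewrite -mulr_suml divff// gt_eqF.
Qed.

Lemma expect_itv_neq (R : realType) (a b c : R) (mu : probability R R) :
  expect_itv a b mu (fun x => `|x - c|) <= 0 ->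
  expect_itv a b mu (\1_(~` [set c])) <= 0.
Proof.
move=> le0.
have mdev : bmeas a b (fun x => x - c).
  by apply: bmeasD; [exact: bmeas_id|exact: bmeas_cst].
have ind : measurable_fun [set: R] (\1_(~` [set c]) : R -> R).
  by apply/measurable_indicP; exact: measurableC.
have dev0 : (\int[mu]_(x in `[a, b]) `|(x - c)%:E| = 0)%E.
  have f0 := expect_itv_ge0 mu (fun x (_ : a <= x <= b) => normr_ge0 (x - c)).
  have e0 : expect_itv a b mu (fun x => `|x - c|) = 0 by apply/le_anti/andP.
  rewrite -[RHS]/(0%:E) -e0 /expect_itv /Rintegral fineK//.
  exact/integrable_fin_num/bmeas_integrable/bmeas_norm.
have : (\int[mu]_(x in `[a, b]) `|((\1_(~` [set c]) : R -> R) x)%:E| = 0)%E.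
  apply/ae_eq_integral_abs => //.
    by apply/measurable_EFinP; exact: measurable_funTS.
  have : ae_eq mu [set` `[a, b]] (fun x => (x - c)%:E) (cst 0%E).
    by apply/ae_eq_integral_abs => //; apply/measurable_EFinP/measurable_funTS; exact: mdev.1.
  apply: filterS => x /= h xab; have [xc] := h xab.
  by rewrite indicE memNset//=; apply; apply/eqP; rewrite -subr_eq0 xc.
rewrite /expect_itv /Rintegral => h.
rewrite (_ : (\int[mu]_(x in `[a, b]) _)%E = 0%E)// -h.
by apply: eq_integral => x _; rewrite /= ger0_norm.
Qed.

(* The indicator branch covers [eps = 0], where Markov's inequality is vacuous. *)
Lemma markov_weight (R : realType) (n : nat) (a b eps c : R)
    (mu : probability R R) :
  (0 < n)%N -> 0 <= eps ->
  expect_itv a b mu (fun x => `|x - c|) <= eps / n%:R ->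
  exists w : R -> R, [/\ bmeas a b w, forall x, 0 <= w x,
    n%:R * expect_itv a b mu w <= 10^-1 &
    forall u : 'I_n -> R, \sum_j w (u j) < 1 ->
      \sum_j `|u j - c| <= 10 * eps].
Proof.
move=> n0 eps0 dev; have nR : 0 < n%:R :> R by rewrite ltr0n.
have mdev : bmeas a b (fun x => `|x - c|).
  apply: (@bmeas_norm _ _ _ (fun x => x - c)).
  by apply: bmeasD; [exact: bmeas_id|exact: bmeas_cst].
move: eps0; rewrite le_eqVlt => /orP[/eqP e0|e0].
  exists (\1_(~` [set c])); split.
  - split; first by apply/measurable_indicP; exact: measurableC.
    by exists 1 => x _; rewrite indicE ger0_norm//; case: (_ \in _).
  - by move=> x; rewrite indicE.
  - apply: (@le_trans _ _ 0); last by rewrite invr_ge0.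
    by rewrite pmulr_rle0// expect_itv_neq//; rewrite -e0 mul0r in dev.
  - move=> u su; rewrite -e0 mulr0 big1// => j _.
    apply/eqP; rewrite normr_eq0 subr_eq0; apply: contraTT su => ujc.
    rewrite -leNgt (bigD1 j)//= indicE mem_set; last by move=> /= uj; rewrite uj eqxx in ujc.
    by rewrite lerDl sumr_ge0.
(* The scaling makes the expected total at most 1/10, and expresses the Markov event as a sum over
   coordinates. *)
exists (fun x => (10 * eps)^-1 * `|x - c|); split.
- exact: bmeasZ.
- by move=> x; rewrite mulr_ge0// invr_ge0 mulr_ge0// ltW.
- rewrite expect_itvZ// mulrCA mulrC ler_pdivrMr ?mulr_gt0//.
  rewrite mulrA mulVf// mul1r mulrC -ler_pdivlMr//.
- move=> u; rewrite -mulr_sumr mulrC ltr_pdivrMr ?mulr_gt0// mul1r.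
  exact: ltW.
Qed.

Lemma expect_itv_mean_in (R : realType) (a b : R) (mu : probability R R) :
  mu [set` `[a, b]] = 1%E -> a <= expect_itv a b mu (fun x => x) <= b.
Proof.
move=> mu1; have mid := @bmeas_id R a b.
apply/andP; split.
  rewrite -[leLHS](expect_itv_cst a mu1); apply: expect_itv_le => //.
    exact: bmeas_cst.
  by move=> x /andP[].
rewrite -[leRHS](expect_itv_cst b mu1); apply: expect_itv_le => //.
  exact: bmeas_cst.
by move=> x /andP[].
Qed.

(** Both [x] and [c] lie in [a, b], so one factor of the square is at most [b - a]. This is how the
    short support controls the variances. *)
Lemma expect_itv_sqr_dev_le (R : realType) (a b c : R) (mu : probability R R) :
  a <= c <= b ->
  expect_itv a b mu (fun x => (x - c) ^+ 2) <=
  (b - a) * expect_itv a b mu (fun x => `|x - c|).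
Proof.
move=> /andP[ac cb].
have mdev : bmeas a b (fun x => x - c).
  by apply: bmeasD; [exact: bmeas_id|exact: bmeas_cst].
rewrite -expect_itvZ; last exact: (bmeas_norm mdev).
apply: expect_itv_le.
- exact: (bmeas_exp 2 mdev).
- exact/bmeasZ/(bmeas_norm mdev).
- move=> x /andP[ax xb]; rewrite -real_normK ?num_real// expr2 ler_wpM2r//.
  by rewrite ler_norml; apply/andP; split; lra.
Qed.

(** * Acceptance bounds in the close and far cases *)

(** With S the sum of [u], the acceptance probability is at least 784/1000 - sum_j w(u_j) - 25 (S -
    1)^2: if the weights sum to at least 1 or |S - 1| > 1/5, this bound is negative. Averaging gives
    at least 784/1000 - 1/10 - 25/1000. *)
Lemma close_expect_poissonized_ge (R : realType) (eps1 eps2 a b : R)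
    (n m s : nat) (mu : probability R R) (T : {ffun 'I_s -> 'I_n} -> R) :
  (0 < n)%N -> (1000 <= m)%N -> s%:R < m%:R / 2 :> R ->
  0 <= eps1 -> eps1 <= 1 -> 0 <= a -> b - a <= 1000^-1 ->
  mu [set` `[a, b]] = 1%E ->
  expect_itv a b mu (fun x => x) = n%:R^-1 ->
  expect_itv a b mu (fun x => `|x - n%:R^-1|) <= eps1 / n%:R ->
  tester_succeeds T (25 * eps1) (eps2 / 2) ->
  3 / 5 <= expect_poissonized a b mu m (2 * m) T.
Proof.
move=> n0 m1000 sm e0 e1 a0 ba mu1 mean dev [TT succ].
have nR : 0 < n%:R :> R by rewrite ltr0n.
have mR : 1000 <= m%:R :> R by rewrite ler_nat.
have [w [mw w0 Ew wL]] := markov_weight n0 e0 dev.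
have mdev : bmeas a b (fun x => x - n%:R^-1).
  by apply: bmeasD; [exact: bmeas_id|exact: bmeas_cst].
have dev0 : expect_itv a b mu (fun x => x - n%:R^-1) = 0.
  rewrite expect_itvD; [|exact: bmeas_id|exact: bmeas_cst].
  by rewrite mean expect_itv_cst// subrr.
(* 784/1000 is 98/100, the window mass, times 4/5, the success probability. *)
have H1 := @has_expect_cst R n a b (784 / 1000) _ mu1.
have H2 := has_expectZ (-1) (has_expect_sum (index_enum 'I_n)
  (fun j => has_expect_coord j mu1 mw)).
have H3 := has_expectZ (-25) (has_expect_sqr n mu1 mdev dev0).
have H := has_expect_le (has_expectD (has_expectD H1 H2) H3)
  (@has_expect_poissonized R n s m (2 * m) a b mu T a0).
apply: le_trans (H _) => {H H1 H2 H3}.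
  have := expect_itv_sqr_dev_le mu (c := n%:R^-1) (a := a) (b := b).
  rewrite -{1 2}mean => /(_ (expect_itv_mean_in mu1)) sq.
  have {}sq : n%:R * expect_itv a b mu (fun x => (x - n%:R^-1) ^+ 2) <= 1000^-1.
    apply: le_trans (ler_wpM2l (ltW nR) sq) _; rewrite mulrCA.
    have /andP[ax xb] := expect_itv_mean_in mu1.
    rewrite -[leRHS]mulr1; apply: ler_pM => //.
    - by rewrite subr_ge0 (le_trans ax).
    - by rewrite mulr_ge0 ?expect_itv_ge0.
    - by rewrite mulrC -ler_pdivlMr//; apply: le_trans dev _; rewrite ler_pM2r ?invr_gt0.
  rewrite sum_ord_const; lra.
move=> u uab.
have u0 j : 0 <= u j by apply: le_trans a0 _; have /andP[] := uab j.
have F0 := poissonized_ge0 m (2 * m) TT u0.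
set S := \sum_j u j.
have -> : \sum_j (u j - n%:R^-1) = S - 1.
  by rewrite sumrB sum_ord_const divff// gt_eqF.
have W0 : 0 <= \sum_j w (u j) by apply: sumr_ge0.
have Q0 := sqr_ge0 (S - 1).
have [W1|W1] := ltP (\sum_j w (u j)) 1; last by lra.
have [S5|S5] := lerP `|S - 1| (1 / 5); last first.
  have : (1 / 5) ^+ 2 <= `|S - 1| ^+ 2 by rewrite lerXn2r ?nnegrE//; lra.
  by rewrite real_normK ?num_real//; lra.
have /andP[Sl Su] : 4 / 5 <= S <= 6 / 5.
  by move: S5; rewrite ler_norml => /andP[]; lra.
have S0 : 0 < S by lra.
rewrite poissonized_prob_close ?gt_eqF// -/S.
have pc : 4 / 5 <= prob_close T (fun j => u j / S).
  apply: (succ _ (is_distr_normalized u0 S0)).1.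
  have := l1_unif_normalized u n0 S0; rewrite ler_norml => /andP[_ l1].
  (* Bounding |S - 1| by the total deviation keeps the error proportional to [eps1]: twice 10 eps1
     is at most 25 eps1 S, as S is at least 4/5. *)
  have SL : `|S - 1| <= \sum_j `|u j - n%:R^-1|.
    by apply: le_trans (ler_norm_sum _ _ _); rewrite sumrB sum_ord_const divff// gt_eqF.
  have L10 := wL _ W1.
  rewrite -(ler_pM2l S0); apply: (@le_trans _ _ (20 * eps1)); first by lra.
  by rewrite mulrA ler_wpM2r//; lra.
(* The mean m S lies in [4m/5, 6m/5] and s < m/2, so D = 3m/10 fits the window; the Chebyshev error
   is at most 40/(3m), below 1/50 for m at least 1000. *)
have win : 98 / 100 <= \sum_(r < 2 * m) poi_pmf (m%:R * S) (r + s).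
  have mS0 : 0 <= m%:R * S by rewrite mulr_ge0// ltW.
  have mSl : m%:R * (4 / 5) <= m%:R * S by rewrite ler_wpM2l.
  have mSu : m%:R * S <= m%:R * (6 / 5) by rewrite ler_wpM2l.
  have D0 : 0 < 3 / 10 * m%:R :> R by lra.
  apply: le_trans (poi_chebyshev (D := 3 / 10 * m%:R) mS0 D0 _ _); last 2 first.
  - by lra.
  - by rewrite natrD natrM; have := ler0n R s; lra.
  rewrite lerBrDl -lerBrDr ler_pdivrMr ?exprn_gt0//.
  have : 1000 * m%:R <= m%:R ^+ 2 :> R by rewrite expr2 ler_wpM2r.
  by rewrite exprMn; lra.
apply: (@le_trans _ _ (98 / 100 * (4 / 5))); first by lra.
by apply: ler_pM => //; lra.
Qed.

(** With V the total deviation and L its mean, the acceptance probability is at most 1/5 + 36 (S -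
    1)^2 / eps2^2 + 16 (V - L)^2 / L^2. If |S - 1| > eps2/6 or |V - L| > L/4, a Chebyshev term is at
    least 1. Averaging gives at most 1/5 + 72/1000 + 16/1000. *)
Lemma far_expect_poissonized_le (R : realType) (eps1 eps2 a b : R)
    (n m s : nat) (mu : probability R R) (T : {ffun 'I_s -> 'I_n} -> R) :
  (0 < n)%N -> 0 < eps2 -> eps2 <= 1 -> 0 <= a -> b - a <= eps2 ^+ 2 / 1000 ->
  mu [set` `[a, b]] = 1%E ->
  expect_itv a b mu (fun x => x) = n%:R^-1 ->
  eps2 / n%:R <= expect_itv a b mu (fun x => `|x - n%:R^-1|) ->
  tester_succeeds T (25 * eps1) (eps2 / 2) ->
  expect_poissonized a b mu m (2 * m) T <= 3 / 10.
Proof.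
move=> n0 e0 e1 a0 ba mu1 mean dev [TT succ].
have nR : 0 < n%:R :> R by rewrite ltr0n.
have mdev : bmeas a b (fun x => x - n%:R^-1).
  by apply: bmeasD; [exact: bmeas_id|exact: bmeas_cst].
have mabs := bmeas_norm mdev.
have dev0 : expect_itv a b mu (fun x => x - n%:R^-1) = 0.
  rewrite expect_itvD; [|exact: bmeas_id|exact: bmeas_cst].
  by rewrite mean expect_itv_cst// subrr.
set theta := expect_itv a b mu (fun x => `|x - n%:R^-1|) in dev.
have mabsdev : bmeas a b (fun x => `|x - n%:R^-1| - theta).
  by apply: bmeasD; [|exact: bmeas_cst].
have absdev0 : expect_itv a b mu (fun x => `|x - n%:R^-1| - theta) = 0.
  by rewrite expect_itvD ?expect_itv_cst ?subrr//; exact: bmeas_cst.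
set L := n%:R * theta.
have eL : eps2 <= L by rewrite /L mulrC -ler_pdivrMr.
have L2 : L <= 2.
  rewrite /L mulrC -ler_pdivlMr//.
  apply: (@le_trans _ _ (expect_itv a b mu (fun x => x + n%:R^-1))).
    apply: expect_itv_le => // [|x /andP[ax _]].
      by apply: bmeasD; [exact: bmeas_id|exact: bmeas_cst].
    have x0 := le_trans a0 ax.
    by apply: le_trans (ler_normB _ _) _; rewrite !ger0_norm// invr_ge0.
  rewrite expect_itvD; [|exact: bmeas_id|exact: bmeas_cst].
  by rewrite mean expect_itv_cst//; lra.
have L0 : 0 < L by lra.
have H1 := @has_expect_cst R n a b (1 / 5) _ mu1.
have H2 := has_expectZ (36 / eps2 ^+ 2) (has_expect_sqr n mu1 mdev dev0).
have H3 := has_expectZ (16 / L ^+ 2) (has_expect_sqr n mu1 mabsdev absdev0).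
have H := has_expect_le (@has_expect_poissonized R n s m (2 * m) a b mu T a0)
  (has_expectD (has_expectD H1 H2) H3).
apply: le_trans (H _) _ => {H H1 H2 H3}; last first.
  have := expect_itv_sqr_dev_le mu (c := n%:R^-1) (a := a) (b := b).
  rewrite -{1 2}mean => /(_ (expect_itv_mean_in mu1)); rewrite -/theta => sq.
  have {}sq : n%:R * expect_itv a b mu (fun x => (x - n%:R^-1) ^+ 2) <=
      eps2 ^+ 2 / 1000 * L.
    apply: le_trans (ler_wpM2l (ltW nR) sq) _; rewrite mulrCA -/L.
    by rewrite ler_wpM2r// ltW.
  (* The variance of |x - 1/n| is its second moment minus theta^2. *)
  have var : expect_itv a b mu (fun x => (`|x - n%:R^-1| - theta) ^+ 2) <=
      expect_itv a b mu (fun x => (x - n%:R^-1) ^+ 2).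
    rewrite (_ : (fun x => (`|x - n%:R^-1| - theta) ^+ 2) =
      (fun x => (x - n%:R^-1) ^+ 2 + ((- 2 * theta) * `|x - n%:R^-1| + theta ^+ 2))).
      rewrite expect_itvD; [|exact: (bmeas_exp 2 mdev)|]; last first.
        by apply: bmeasD; [exact: bmeasZ|exact: bmeas_cst].
      rewrite expect_itvD; [|exact: bmeasZ|exact: bmeas_cst].
      rewrite expect_itvZ// expect_itv_cst// -/theta.
      by have := sqr_ge0 theta; rewrite expr2; lra.
    by apply/funext => x; rewrite -(@real_normK _ (x - n%:R^-1)) ?num_real//; ring.
  have {}var := le_trans (ler_wpM2l (ltW nR) var) sq.
  have e20 : 0 < eps2 ^+ 2 by rewrite exprn_gt0.
  have L20 : 0 < L ^+ 2 by rewrite exprn_gt0.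
  have t1 : 36 / eps2 ^+ 2 * (n%:R * expect_itv a b mu (fun x => (x - n%:R^-1) ^+ 2))
      <= 72 / 1000.
    rewrite mulrAC ler_pdivrMr//.
    have : eps2 ^+ 2 * L <= eps2 ^+ 2 * 2 by rewrite ler_wpM2l// ltW.
    by lra.
  have t2 : 16 / L ^+ 2 * (n%:R * expect_itv a b mu
      (fun x => (`|x - n%:R^-1| - theta) ^+ 2)) <= 16 / 1000.
    rewrite mulrAC ler_pdivrMr//.
    have : eps2 ^+ 2 * L <= L ^+ 2.
      rewrite expr2 [L ^+ 2]expr2 ler_wpM2r ?(ltW L0)//.
      by apply: le_trans eL; rewrite -[leRHS]mulr1 ler_wpM2l// ltW.
    by lra.
  by lra.
move=> u uab.
have u0 j : 0 <= u j by apply: le_trans a0 _; have /andP[] := uab j.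
have F1 := poissonized_le1 m (2 * m) TT u0.
set S := \sum_j u j.
have -> : \sum_j (u j - n%:R^-1) = S - 1.
  by rewrite sumrB sum_ord_const divff// gt_eqF.
have -> : \sum_j (`|u j - n%:R^-1| - theta) = \sum_j `|u j - n%:R^-1| - L.
  by rewrite sumrB sum_ord_const.
set V := \sum_j `|u j - n%:R^-1|.
have q1 : 0 <= 36 / eps2 ^+ 2 * (S - 1) ^+ 2 by rewrite mulr_ge0 ?sqr_ge0// divr_ge0// sqr_ge0.
have q2 : 0 <= 16 / L ^+ 2 * (V - L) ^+ 2 by rewrite mulr_ge0 ?sqr_ge0// divr_ge0// sqr_ge0.
have [S6|S6] := lerP `|S - 1| (eps2 / 6); last first.
  suff : 1 <= 36 / eps2 ^+ 2 * (S - 1) ^+ 2 by lra.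
  rewrite mulrAC ler_pdivlMr ?exprn_gt0// mul1r.
  have : (eps2 / 6) ^+ 2 <= `|S - 1| ^+ 2.
    by rewrite lerXn2r ?nnegrE//; lra.
  by rewrite real_normK ?num_real// expr_div_n; lra.
have [V4|V4] := lerP `|V - L| (L / 4); last first.
  suff : 1 <= 16 / L ^+ 2 * (V - L) ^+ 2 by lra.
  rewrite mulrAC ler_pdivlMr ?exprn_gt0// mul1r.
  have : (L / 4) ^+ 2 <= `|V - L| ^+ 2.
    by rewrite lerXn2r ?nnegrE//; lra.
  by rewrite real_normK ?num_real// expr_div_n; lra.
have /andP[Sl Su] : 5 / 6 <= S <= 7 / 6.
  by move: S6; rewrite ler_norml => /andP[]; lra.
have S0 : 0 < S by lra.
have Vl : 3 / 4 * eps2 <= V by move: V4; rewrite ler_norml => /andP[]; lra.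
rewrite poissonized_prob_close ?gt_eqF// -/S.
(* S times the l1 distance is at least V - |S - 1|, hence at least (3/4 - 1/6) eps2 = (7/6)(eps2/2),
   and S is at most 7/6. *)
have pc : 4 / 5 <= 1 - prob_close T (fun j => u j / S).
  apply: (succ _ (is_distr_normalized u0 S0)).2.
  have := l1_unif_normalized u n0 S0; rewrite ler_norml -/V => /andP[l1 _].
  rewrite -(ler_pM2l S0); apply: (@le_trans _ _ (7 / 6 * (eps2 / 2))).
    by rewrite ler_wpM2r//; lra.
  by lra.
have pc0 : 0 <= prob_close T (fun j => u j / S).
  by apply: prob_close_ge0 => // j; rewrite divr_ge0// ltW.
have mS0 : 0 <= m%:R * S by rewrite mulr_ge0// ltW.
have := ler_wpM2r pc0 (sum_poi_shift_le1 s (2 * m) mS0).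
by rewrite mul1r; lra.
Qed.

(** * Comparison of the two acceptance probabilities *)

Theorem theorem3p4 :
  exists c : nat, (0 < c)%N /\
  forall (R : realType) (eps1 eps2 : R) (n m : nat),
    0 <= eps1 -> eps1 < eps2 -> eps2 <= 1 ->
    (0 < n)%N -> (0 < m)%N -> (c <= m)%N ->
  forall (mu mu' : probability R R) (a b : R),
    0 <= a -> a < b -> b - a <= eps2 ^+ 2 / 1000%:R ->
    mu [set` `[a, b]] = 1%E -> mu' [set` `[a, b]] = 1%E ->
    (\int[mu]_x x%:E)%E = (n%:R^-1)%:E ->
    (\int[mu']_x x%:E)%E = (n%:R^-1)%:E ->
    (\int[mu]_x `|x - n%:R^-1|%:E <= (eps1 / n%:R)%:E)%E ->
    ((eps2 / n%:R)%:E <= \int[mu']_x `|x - n%:R^-1|%:E)%E ->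
    (tv_nat (poi_mix mu m) (poi_mix mu' m) <= ((20 * n%:R)^-1)%:E)%E ->
  forall (s : nat) (T : {ffun 'I_s -> 'I_n} -> R),
    tester_succeeds T (25 * eps1) (eps2 / 2) ->
    m%:R / 2 <= s%:R :> R.
Proof.
exists 1000%N; split=> // R eps1 eps2 n m e0 e12 e1 n0 _ m1000 mu mu' a b a0 ab ba
  mu1 mu1' mean mean' dev dev' tv s T TT.
have mid := @bmeas_id R a b.
have mabs : bmeas a b (fun x => `|x - n%:R^-1|).
  apply: (@bmeas_norm _ _ _ (fun x => x - n%:R^-1)).
  by apply: bmeasD; [exact: bmeas_id|exact: bmeas_cst].
move: mean mean' dev dev'.
rewrite (integral_expect_itv mu1 mid) (integral_expect_itv mu1' mid).
rewrite (integral_expect_itv mu1 mabs) (integral_expect_itv mu1' mabs) => -[mean] [mean'].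
rewrite !lee_fin => dev dev'.
rewrite leNgt; apply/negP => sm.
have e20 : 0 < eps2 by apply: le_lt_trans e12.
have e2sq : eps2 ^+ 2 <= 1 by rewrite expr_le1// ltW.
have ba1 : b - a <= 1000^-1 by lra.
have close := close_expect_poissonized_ge n0 m1000 sm e0
  (ltW (lt_le_trans e12 e1)) a0 ba1 mu1 mean dev TT.
have far := far_expect_poissonized_le m n0 e20 e1 a0 ba mu1' mean' dev' TT.
have := expect_poissonized_sub_le (2 * m) a0 mu1 mu1' tv TT.1.
(* The averaged acceptance probabilities differ by at least 3/5 - 3/10, but by at most 1/10
   according to the total variation bound. *)
have -> : n%:R * (2 * (20 * n%:R)^-1) = 1 / 10 :> R.
  by field; rewrite pnatr_eq0 -lt0n n0.
by lra.
Qed.
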